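(* Let $m\ge 2$ and $n\ge m$ be integers, let $X_1,\ldots,X_n$ be i.i.d. random variables with values in a measurable space $\mathcal{X}$, and let $h:\mathcal{X}^m\to\mathbb{R}$ be measurable with $\mathrm{E}|h(X_1,\ldots,X_m)|<\infty$. Let $m_h=\mathrm{E}\,h(X_1,\ldots,X_m)$, let $U_n(h)$ be the U-statistic of order $m$ with kernel $h$, and let $k=\lfloor n/m\rfloor$. Let $Z_1,\ldots,Z_k$ be i.i.d. copies of $h(X_1,\ldots,X_m)$ and $\bar Z_k=\frac1k\sum_{i=1}^k Z_i$. Then for every convex function $\Phi:\mathbb{R}\to\mathbb{R}$, $$\mathrm{E}\,\Phi(U_n(h)-m_h)\le \mathrm{E}\,\Phi(\bar Z_k-m_h).$$ In particular, for all $s\in\mathbb{R}$, $$\mathrm{E}\,e^{s(U_n(h)-m_h)}\le\left(\mathrm{E}\,e^{(s/k)(Z_1-m_h)}\right)^k.$$ (Expectations may take the value $+\infty$.)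
   Context: The U-statistic of order $m$ with kernel $h$ based on $X_1,\ldots,X_n$ is $$U_n(h)=\frac{(n-m)!}{n!}\sum_{(i_1,\ldots,i_m)\in I_n^m}h(X_{i_1},\ldots,X_{i_m}),$$ where $I_n^m=\{(i_1,\ldots,i_m):1\le i_j\le n,\ i_j\ne i_l\text{ if }j\ne l\}$ is the set of all $m$-tuples of distinct integers between $1$ and $n$. The kernel $h$ is not assumed symmetric. *)

(* Defs.v *)
From HB Require Import structures.
From mathcomp Require Import all_boot all_order all_algebra.
From mathcomp Require Import all_classical all_reals all_analysis.

Set Implicit Arguments.
Unset Strict Implicit.
Unset Printing Implicit Defensive.

Import Order.TTheory GRing.Theory Num.Theory.
Import numFieldNormedType.Exports.

Local Open Scope classical_set_scope.
Local Open Scope ring_scope.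

Definition mutually_independent (R : realType) d (Omega : measurableType d)
    (P : probability Omega R) d' (T : measurableType d') (I : finType)
    (X : I -> {RV P >-> T}) : Prop :=
  forall (J : {set I}) (A : I -> set T),
    (forall i, i \in J -> measurable (A i)) ->
    P (\bigcap_(i in [set` J]) (X i @^-1` A i)) =
    (\prod_(i in J) P (X i @^-1` A i))%E.

(* Equality of laws is only required on measurable sets: a measure is a total
   function on sets whose values outside the sigma-algebra carry no meaning. *)
Definition same_law (R : realType) d1 (Omega1 : measurableType d1)
    (P1 : probability Omega1 R) d2 (Omega2 : measurableType d2)
    (P2 : probability Omega2 R) d (T : measurableType d)
    (X : Omega1 -> T) (Y : Omega2 -> T) : Prop :=
  forall A : set T, measurable A -> P1 (X @^-1` A) = P2 (Y @^-1` A).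

Definition iid (R : realType) d (Omega : measurableType d)
    (P : probability Omega R) d' (T : measurableType d') (I : finType)
    (X : I -> {RV P >-> T}) : Prop :=
  mutually_independent X /\ forall i j, same_law P P (X i) (X j).

Definition first_vars (m n : nat) (le_mn : (m <= n)%N) (T : Type)
    (x : 'I_n -> T) : m.-tuple T :=
  [tuple x (widen_ord le_mn j) | j < m].

(* The index set I_n^m is the set of duplicate-free m-tuples over 'I_n. *)
Definition Ustat (R : realType) (T : Type) (m n : nat) (h : m.-tuple T -> R)
    (x : 'I_n -> T) : R :=
  (n - m)`!%:R / n`!%:R *
  \sum_(i : m.-tuple 'I_n | uniq i) h [tuple x (tnth i j) | j < m].

Definition sample_mean (R : realType) (k : nat) (z : 'I_k -> R) : R :=
  k%:R^-1 * \sum_(i < k) z i.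

Lemma divn_gt0_of_le (m n : nat) : (2 <= m)%N -> (m <= n)%N -> (0 < n %/ m)%N.
Proof. by move=> hm hmn; rewrite divn_gt0 // (leq_trans _ hm). Qed.

(* Main.v *)
Require Import Defs.
From HB Require Import structures.
From mathcomp Require Import all_boot all_order all_algebra all_fingroup.
From mathcomp Require Import primitive_action alt.
From mathcomp Require Import all_classical all_reals all_analysis.
From mathcomp Require Import measurable_realfun.
From mathcomp Require Import ring lra.

Set Implicit Arguments.
Unset Strict Implicit.
Unset Printing Implicit Defensive.

Import Order.TTheory GRing.Theory Num.Theory.
Import numFieldNormedType.Exports.

Local Open Scope ring_scope.

(** The argument is Hoeffding's. Cut [0, n) into k = n %/ m disjoint blocks of
  m consecutive indices and a remainder. For a permutation s, the mean W_s of
  the k values of h on the s-permuted blocks uses each variable at most once,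
  so it is a mean of k independent copies of h(X_1, ..., X_m): W_s has the law
  of Zbar_k whatever s is ([block_mean_same_law]). On the other hand, a fixed
  block is sent onto each m-tuple of distinct indices by the same number
  (n - m)! of permutations, so U_n(h) is the plain average of the n! variables
  W_s ([Ustat_mean_block_mean]). The W_s are strongly dependent, but convexity
  only sees their marginal laws: Phi(U_n - m_h) is at most the average of the
  Phi(W_s - m_h), and each of these has the expectation of Phi(Zbar_k - m_h)
  ([expectation_convex_mean]). The exponential bound is the case
  Phi(x) = exp(s x), for which the right-hand side factorises by independence
  ([expectation_expR_sample_mean]).

  The measure-theoretic work is of three kinds. Equality of laws of tuples and
  independence of blocks both come from uniqueness of finite measures on the
  pi-system of boxes ([tuple_measure_unique], [product_rule_measurable]). The
  expectation of a product of independent nonnegative variables comes from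
  Tonelli's theorem ([integral_prod_product_rule]). Finally, the expectation
  of a convex function of an integrable variable is well defined in
  ]-oo, +oo], since a convex function is bounded below by a function of linear
  growth ([convex_function_minorant]); when the right-hand side is not finite
  it is therefore +oo, and otherwise every variable in sight is integrable. *)

(** * The U-statistic as an average over permutations *)

(** S_n acts transitively on m-tuples of distinct points, so every such tuple
  is hit equally often by s |-> s \o b. Counting with F = 1, where the left
  side is n! and there are n!/(n - m)! tuples, gives the multiplicity. *)
Lemma sum_perm_injective (V : nmodType) (m n : nat) (b : 'I_m -> 'I_n)
    (F : m.-tuple 'I_n -> V) : injective b ->
  \sum_(s : 'S_n) F [tuple s (b j) | j < m] =
  (\sum_(t : m.-tuple 'I_n | uniq t) F t) *+ (n - m)`!.
Proof.
move=> b_inj.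
have le_mn : (m <= n)%N.
  by rewrite -[m]card_ord -[n]card_ord; exact: leq_card b_inj.
have uniq_b (s : 'S_n) : uniq [tuple s (b j) | j < m].
  by rewrite map_inj_uniq ?enum_uniq// => i j /perm_inj/b_inj.
pose t0 := [tuple b j | j < m].
have actE (s : 'S_n) : [tuple s (b j) | j < m] = ('P * m)%act t0 s.
  by apply: eq_from_tnth => j; rewrite tnth_mktuple tnth_map tnth_mktuple.
have uniq0 : t0 \in dtuple_on m [set: 'I_n].
  by apply/dtuple_onP; split=> [i j|i]; rewrite ?inE// !tnth_mktuple => /b_inj.
have tr : [transitive^m 'Sym_('I_n), on finset.setT | 'P].
  apply: (@ntransitive_weak _ _ _ _ _ m n) => //.
  by have := Sym_trans 'I_n; rewrite card_ord.
pose c := #|'C_('Sym_('I_n))[t0 | 'P * m]%g|.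
(* The permutations sending b to t form a right coset of the stabiliser of b. *)
have fibre (t : m.-tuple 'I_n) : uniq t ->
    #|[pred s : 'S_n | [tuple s (b j) | j < m] == t]| = c.
  move=> ut.
  have td : t \in dtuple_on m [set: 'I_n].
    by apply/dtuple_onP; split=> [|i]; [exact/tuple_uniqP|rewrite inE].
  have [a aS ->] := atransP2 tr uniq0 td.
  rewrite -[RHS](card_rcoset _ a) -amove_act//.
  by apply: eq_card => s; rewrite !inE actE.
have main (W : nmodType) (G : m.-tuple 'I_n -> W) :
    \sum_(s : 'S_n) G [tuple s (b j) | j < m] =
    (\sum_(t : m.-tuple 'I_n | uniq t) G t) *+ c.
  rewrite (partition_big (fun s : 'S_n => [tuple s (b j) | j < m])
    (fun t => uniq t))/=; last by move=> s _; exact: uniq_b.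
  rewrite -sumrMnl; apply: eq_bigr => t ut.
  rewrite (eq_bigr (fun=> G t)); last by move=> s /eqP ->.
  by rewrite sumr_const fibre.
suff Ec : ((n - m)`! = c)%N by rewrite Ec; exact: main.
(* The common size c of the fibres is found by taking the constant 1 for F. *)
have := main nat (fun=> 1%N).
rewrite !sumr_const !natn.
have -> : #|[pred t : m.-tuple 'I_n | uniq t]| = n ^_ m.
  rewrite -[in RHS](card_ord n) -(card_uniq_tuples m 'I_n).
  by apply: eq_card => t; rewrite !inE all_predT.
rewrite card_Sn -(ffact_fact le_mn).
have := ffact_gt0 n m; rewrite le_mn => f_gt0.
by rewrite -mulr_natr natn => /eqP; rewrite eqn_pmul2l// => /eqP.
Qed.

Fact block_index_subproof (m n : nat) (i : 'I_(n %/ m)) (j : 'I_m) :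
  (i * m + j < n)%N.
Proof.
apply: (@leq_trans (i.+1 * m)%N); first by rewrite mulSn addnC ltn_add2r.
by rewrite (leq_trans _ (leq_trunc_div n m))// leq_mul2r ltn_ord orbT.
Qed.

Definition block_index (m n : nat) (i : 'I_(n %/ m)) (j : 'I_m) : 'I_n :=
  Ordinal (block_index_subproof i j).

Lemma block_index_inj (m n : nat) (i i' : 'I_(n %/ m)) (j j' : 'I_m) :
  block_index i j = block_index i' j' -> i = i' /\ j = j'.
Proof.
move=> /(congr1 val)/= e.
have m_gt0 : (0 < m)%N := leq_ltn_trans (leq0n _) (ltn_ord j).
have quot (a : nat) (c : 'I_m) : ((a * m + c) %/ m = a)%N.
  by rewrite divnMDl// divn_small ?addn0.
have rem (a : nat) (c : 'I_m) : ((a * m + c) %% m = c)%N.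
  by rewrite modnMDl modn_small.
by split; apply: val_inj => /=;
  [rewrite -(quot i j) e quot|rewrite -(rem i j) e rem].
Qed.

Definition block_tuple (T : Type) (m n : nat) (x : 'I_n -> T)
    (i : 'I_(n %/ m)) : m.-tuple T :=
  [tuple x (block_index i j) | j < m].

Definition block_mean (R : realType) (T : Type) (m n : nat)
    (h : m.-tuple T -> R) (x : 'I_n -> T) : R :=
  sample_mean (fun i : 'I_(n %/ m) => h (block_tuple x i)).

(** Exchanging the sums over blocks and permutations, every one of the k blocks
  contributes the same sum over distinct tuples. *)
Lemma Ustat_mean_block_mean (R : realType) (T : Type) (m n : nat)
    (h : m.-tuple T -> R) (x : 'I_n -> T) : (0 < n %/ m)%N ->
  Ustat h x = n`!%:R^-1 * \sum_(s : 'S_n) block_mean h (x \o s).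
Proof.
move=> k_gt0.
have k_neq0 : (n %/ m)%:R != 0 :> R by rewrite pnatr_eq0 -lt0n.
pose F (t : m.-tuple 'I_n) := h [tuple x (tnth t j) | j < m].
have blockE (i : 'I_(n %/ m)) :
    \sum_(s : 'S_n) h (block_tuple (x \o s) i) =
    (n - m)`!%:R * \sum_(t : m.-tuple 'I_n | uniq t) F t.
  rewrite mulr_natl -(@sum_perm_injective _ _ _ (block_index i)); last first.
    by move=> j j' /block_index_inj[].
  apply: eq_bigr => s _; rewrite /F; congr (h _).
  by apply: eq_from_tnth => j; rewrite !tnth_mktuple.
rewrite /Ustat /block_mean /sample_mean -mulr_sumr exchange_big/=.
rewrite (eq_bigr _ (fun i _ => blockE i)) sumr_const card_ord.
by rewrite -[X in _ * (_ * X)]mulr_natl mulKf// mulrA [_^-1 * _]mulrC.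
Qed.

Local Open Scope classical_set_scope.

(** * Measures on tuples and the pi-system of boxes *)

Definition box d (T : measurableType d) (n : nat) : set (set (n.-tuple T)) :=
  [set C | exists2 A : 'I_n -> set T, forall i, measurable (A i)
         & C = [set t | forall i, A i (tnth t i)]].

Lemma box_setI_closed d (T : measurableType d) (n : nat) :
  setI_closed (@box d T n).
Proof.
move=> _ _ [A mA ->] [B mB ->]; exists (fun i => A i `&` B i).
  by move=> i; exact: measurableI.
apply/seteqP; split=> t /=; first by move=> [At Bt] i; split.
by move=> AB; split=> i; have [] := AB i.
Qed.

Lemma boxT d (T : measurableType d) (n : nat) : @box d T n setT.
Proof. by exists (fun=> setT) => //; apply/seteqP; split. Qed.

Lemma box_generate d (T : measurableType d) (n : nat) :
  @measurable _ (n.-tuple T) = <<s @box d T n >>.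
Proof.
apply/seteqP; split; last first.
  apply: smallest_sub; first exact: sigma_algebra_measurable.
  move=> _ [A mA ->].
  rewrite (_ : [set _ | _] = \bigcap_(i in setT) ((@tnth n T)^~ i @^-1` A i)).
    apply: fin_bigcap_measurable => // i _.
    by rewrite -[X in measurable X]setTI; exact: measurable_tnth.
  by apply/seteqP; split=> t /= At i; [move=> _|]; exact: At.
apply: smallest_sub; first exact: smallest_sigma_algebra.
rewrite -bigcup_seq => C [i _ [A mA <-]]; apply: sub_sigma_algebra.
exists (fun j => if j == i then A else setT).
  by move=> j; case: eqP.
apply/seteqP; split=> t /=.
  by move=> [_ At] j; case: eqP => // ->.
by move=> /(_ i); rewrite eqxx.
Qed.

(** Boxes form a pi-system generating the sigma-algebra of tuples, so this is an
  instance of Dynkin's uniqueness theorem. *)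
Lemma tuple_measure_unique d (T : measurableType d) (R : realType) (n : nat)
    (m1 m2 : {measure set (n.-tuple T) -> \bar R}) :
  (m1 setT < +oo)%E ->
  (forall A : 'I_n -> set T, (forall i, measurable (A i)) ->
     m1 [set t | forall i, A i (tnth t i)] =
     m2 [set t | forall i, A i (tnth t i)]) ->
  forall C, measurable C -> m1 C = m2 C.
Proof.
move=> m1fin m12; apply: (measure_unique (@box d T n) (fun=> setT)) => //.
- exact: box_generate.
- exact: box_setI_closed.
- by move=> _; exact: boxT.
- by rewrite bigcup_const//; exists 0%N.
- by move=> _ [A mA ->]; exact: m12.
Qed.

(** * Independence *)

Definition joint d (Omega : measurableType d) d' (T : measurableType d')
    (n : nat) (Y : 'I_n -> {mfun Omega >-> T}) (w : Omega) : n.-tuple T :=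
  [tuple Y i w | i < n].

Lemma measurable_joint d (Omega : measurableType d) d' (T : measurableType d')
    (n : nat) (Y : 'I_n -> {mfun Omega >-> T}) :
  measurable_fun [set: Omega] (joint Y).
Proof.
apply/measurable_fun_tnthP => i.
rewrite (_ : _ \o _ = Y i); first exact: measurable_funP.
by apply/funext => w /=; rewrite tnth_mktuple.
Qed.

HB.instance Definition _ d (Omega : measurableType d) d'
    (T : measurableType d') (n : nat) (Y : 'I_n -> {mfun Omega >-> T}) :=
  isMeasurableFun.Build _ _ _ _ (joint Y) (measurable_joint Y).

Lemma joint_box d (Omega : measurableType d) d' (T : measurableType d')
    (n : nat) (Y : 'I_n -> {mfun Omega >-> T}) (A : 'I_n -> set T) :
  joint Y @^-1` [set t | forall i, A i (tnth t i)] =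
  \bigcap_(i in setT) (Y i @^-1` A i).
Proof.
apply/seteqP; split=> w /= Aw i; first by have := Aw i; rewrite tnth_mktuple.
by rewrite tnth_mktuple; exact: Aw.
Qed.

(** Independence relative to a class G of test events. Only the full
  intersection is asked for: when G contains the whole space, subfamilies are
  recovered by taking A i = setT. Letting G vary is what allows independence to
  be checked on boxes only. *)
Definition product_rule (R : realType) d (Omega : measurableType d)
    (P : probability Omega R) d' (T : measurableType d') (I : finType)
    (Y : I -> {RV P >-> T}) (G : set (set T)) : Prop :=
  forall A : I -> set T, (forall i, G (A i)) ->
    P (\bigcap_(i in setT) (Y i @^-1` A i)) = (\prod_i P (Y i @^-1` A i))%E.

(** The events are enlarged from G to all measurable sets one index at a time:
  with the other events fixed, both sides of the product rule are finite
  measures in the remaining event, and they agree on the pi-system G. *)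
Lemma product_rule_measurable (R : realType) d (Omega : measurableType d)
    (P : probability Omega R) d' (T : measurableType d') (J : finType)
    (Y : J -> {RV P >-> T}) (G : set (set T)) :
  @measurable _ T = <<s G >> -> setI_closed G -> G setT ->
  product_rule Y G -> product_rule Y measurable.
Proof.
move=> mG GI GT prG.
have G_measurable B : G B -> measurable B.
  by rewrite mG => GB; exact: sub_sigma_algebra.
(* s lists the indices whose event is allowed to leave G. *)
suff extend (s : seq J) (A : J -> set T) : (forall i, measurable (A i)) ->
    (forall i, i \notin s -> G (A i)) ->
    P (\bigcap_(i in setT) (Y i @^-1` A i)) = (\prod_i P (Y i @^-1` A i))%E.
  by move=> A mA; apply: (extend (enum J)) => // i; rewrite mem_enum.
elim: s A => [A _ GA|a s IH A mA GA]; first by apply: prG => i; exact: GA.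
pose upd B i := if i == a then B else A i.
have updA : upd (A a) = A.
  by apply/funext => i; rewrite /upd; case: eqP => // ->.
pose C := \bigcap_(i in [set i | i != a]) (Y i @^-1` A i).
have mC : measurable C.
  apply: fin_bigcap_measurable => [|i _]; last exact: measurable_funPTI.
  exact: (@sub_finite_set _ _ [set: J]).
have capE B : \bigcap_(i in setT) (Y i @^-1` upd B i) = Y a @^-1` B `&` C.
  apply/seteqP; split=> w /=.
    move=> Bw; split; first by have := Bw a I; rewrite /upd eqxx.
    by move=> i /= ia; have := Bw i I; rewrite /upd (negbTE ia).
  move=> [Bw Cw] i _; rewrite /upd; case: eqP => [->//|/eqP ia].
  exact: Cw.
pose c := \prod_(i | i != a) fine (P (Y i @^-1` A i)).
have c_ge0 : 0 <= c by apply: prodr_ge0 => i _; exact: fine_ge0.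
have prodE B : (\prod_i P (Y i @^-1` upd B i) = c%:E * P (Y a @^-1` B))%E.
  rewrite (bigD1 a)//= /upd eqxx muleC; congr (_ * _)%E.
  rewrite /c -prodEFin; apply: eq_bigr => i /negbTE ->.
  by rewrite fineK// fin_num_measure//; exact: measurable_funPTI.
(* The measure structure on a pushforward depends on a measurability proof. *)
pose push : {measure set T -> \bar R} := pushforward (mrestr P mC) (Y a).
pose m1 := push (@measurable_funP _ _ _ _ setT (Y a)).
pose m2 : {measure set T -> \bar R} :=
  mscale (NngNum c_ge0) (distribution P (Y a)).
suff : m1 (A a) = m2 (A a).
  rewrite /m1/= /pushforward /mrestr/= -capE updA => ->.
  by rewrite /m2/= /mscale/= /pushforward -prodE updA.
apply: (measure_unique G (fun=> setT)) => //.
- by rewrite bigcup_const//; exists 0%N.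
- move=> B GB; rewrite /m1/= /pushforward /mrestr/= -capE IH.
  + by rewrite prodE.
  + by move=> i; rewrite /upd; case: eqP => // _; exact: G_measurable.
  + move=> i is_; rewrite /upd; case: eqP => // /eqP ia.
    by apply: GA; rewrite inE negb_or ia.
- move=> _; rewrite /m1/= /pushforward /mrestr preimage_setT setTI.
  by rewrite ltey_eq fin_num_measure.
Qed.

Lemma joint_same_law (R : realType) (n : nat) d' (T : measurableType d')
    d1 (Om1 : measurableType d1) (P1 : probability Om1 R)
    d2 (Om2 : measurableType d2) (P2 : probability Om2 R)
    (Y1 : 'I_n -> {RV P1 >-> T}) (Y2 : 'I_n -> {RV P2 >-> T}) :
  product_rule Y1 measurable -> product_rule Y2 measurable ->
  (forall i, same_law P1 P2 (Y1 i) (Y2 i)) ->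
  same_law P1 P2 (joint Y1) (joint Y2).
Proof.
move=> pr1 pr2 Y12.
apply: (@tuple_measure_unique _ _ _ _ (distribution P1 (joint Y1))
  (distribution P2 (joint Y2))).
  by rewrite ltey_eq fin_num_measure.
move=> A mA; transitivity (P1 (\bigcap_(i in setT) (Y1 i @^-1` A i))).
  by rewrite -joint_box.
transitivity (P2 (\bigcap_(i in setT) (Y2 i @^-1` A i))); last first.
  by rewrite -joint_box.
by rewrite pr1// pr2//; apply: eq_bigr => i _; exact: Y12.
Qed.

(** The event attached to i is the intersection of the A j over the preimages
  j of i: this is A j for the unique preimage, and the whole space, of
  probability one, outside the image of f. *)
Lemma product_rule_inj (R : realType) d (Omega : measurableType d)
    (P : probability Omega R) d' (T : measurableType d') (K J : finType)
    (Y : K -> {RV P >-> T}) (f : J -> K) : injective f ->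
  product_rule Y measurable -> product_rule (Y \o f) measurable.
Proof.
move=> f_inj prY A mA.
pose A' i := \bigcap_(j in [set j | f j = i]) A j.
have A'f j : A' (f j) = A j.
  apply/seteqP; split=> t; first by apply.
  by move=> At j' /f_inj ->.
have A'N i : i \notin codom f -> A' i = setT.
  move=> i_codom; apply/seteqP; split=> // t _ j /= fj.
  by rewrite -fj codom_f in i_codom.
rewrite (_ : \bigcap_(j in setT) _ = \bigcap_(i in setT) (Y i @^-1` A' i)).
  rewrite prY.
    rewrite -(@big_rmcond _ _ _ _ _ (fun i => i \in codom f)); last first.
      by move=> i /A'N ->; rewrite preimage_setT probability_setT.
    rewrite (reindex_omap f (fun i => [pick j | f j == i])).
      apply: eq_big => [j|j _]; last by rewrite A'f.
      rewrite codom_f/=.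
      by case: pickP => [j' /eqP/f_inj->|/(_ j)]; rewrite ?eqxx.
    move=> i /codomP[j ->]; case: pickP => [j' /eqP/= ->//|/(_ j)].
    by rewrite eqxx.
  move=> i; apply: fin_bigcap_measurable => [|j _]; last exact: mA.
  exact: (@sub_finite_set _ _ [set: J]).
apply/seteqP; split=> w /= Aw i _; last by rewrite -A'f; exact: Aw.
by move=> j /= fj; rewrite -fj; exact: (Aw j).
Qed.

Lemma mutually_independent_product_rule (R : realType) d
    (Omega : measurableType d) (P : probability Omega R) d'
    (T : measurableType d') (K : finType) (Y : K -> {RV P >-> T}) :
  mutually_independent Y -> product_rule Y measurable.
Proof.
move=> indY A mA; have := indY finset.setT A (fun i _ => mA i).
rewrite (_ : [set` _] = [set: K]).
  by move=> ->; apply: eq_bigl => i; rewrite finset.in_setT.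
by apply/seteqP; split=> i //= _; rewrite finset.in_setT.
Qed.

(** Disjoint groups of independent variables are independent: on boxes this is
  associativity of the product, and boxes suffice. *)
Lemma product_rule_joint (R : realType) d (Omega : measurableType d)
    (P : probability Omega R) d' (T : measurableType d') (k m : nat)
    (Y : 'I_k * 'I_m -> {RV P >-> T}) :
  product_rule Y measurable ->
  product_rule (fun i => joint (fun j => Y (i, j)) : {RV P >-> m.-tuple T})
    measurable.
Proof.
move=> prY; apply: (@product_rule_measurable _ _ _ _ _ _ _ _ (@box _ T m)).
- exact: box_generate.
- exact: box_setI_closed.
- exact: boxT.
move=> C boxC.
have /choice[A AC] : forall i, exists A : 'I_m -> set T,
    (forall j, measurable (A j)) /\ C i = [set t | forall j, A j (tnth t j)].
  by move=> i; have [A mA CE] := boxC i; exists A.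
rewrite (_ : \bigcap_(i in setT) _ =
    \bigcap_(p in setT) (Y p @^-1` A p.1 p.2)); last first.
  under eq_bigcapr do rewrite (AC _).2 joint_box.
  apply/seteqP; split=> w /= Aw; first by move=> [i j] _; exact: (Aw i _ j).
  by move=> i _ j _; exact: (Aw (i, j)).
rewrite prY; last by move=> [i j]; exact: (AC i).1.
rewrite [RHS](eq_bigr (fun i => \prod_j P (Y (i, j) @^-1` A i j))%E).
  by rewrite pair_big/=; apply: eq_bigr => -[i j].
move=> i _; rewrite (AC i).2 joint_box.
apply: (product_rule_inj (f := fun j => (i, j)) _ prY); last exact: (AC i).1.
by move=> j j' [].
Qed.

Lemma product_rule_comp (R : realType) d (Omega : measurableType d)
    (P : probability Omega R) d' (T : measurableType d')
    d'' (T' : measurableType d'') (K : finType)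
    (Y : K -> {RV P >-> T}) (f : {mfun T >-> T'}) :
  product_rule Y measurable ->
  product_rule (fun i => f \o Y i : {RV P >-> T'}) measurable.
Proof.
move=> prY A mA.
by apply: (prY (fun i => f @^-1` A i)) => i; exact: measurable_funPTI.
Qed.

(** * Transfer of expectations, and expectations of products *)

Lemma same_law_ge0_integral (R : realType) d1 (Om1 : measurableType d1)
    (P1 : probability Om1 R) d2 (Om2 : measurableType d2)
    (P2 : probability Om2 R) d (T : measurableType d)
    (X1 : {RV P1 >-> T}) (X2 : {RV P2 >-> T}) (f : T -> \bar R) :
  same_law P1 P2 X1 X2 -> measurable_fun [set: T] f -> (forall t, 0 <= f t)%E ->
  (\int[P1]_w f (X1 w) = \int[P2]_w f (X2 w))%E.
Proof.
move=> X12 mf f0.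
transitivity (\int[distribution P1 X1]_t f t)%E.
  by rewrite ge0_integral_distribution.
transitivity (\int[distribution P2 X2]_t f t)%E.
  by apply: eq_measure_integral => A mA _; apply: X12.
by rewrite ge0_integral_distribution.
Qed.

(** Positive and negative parts are transferred separately, which also covers
  infinite integrals. *)
Lemma same_law_integral (R : realType) d1 (Om1 : measurableType d1)
    (P1 : probability Om1 R) d2 (Om2 : measurableType d2)
    (P2 : probability Om2 R) d (T : measurableType d)
    (X1 : {RV P1 >-> T}) (X2 : {RV P2 >-> T}) (f : T -> \bar R) :
  same_law P1 P2 X1 X2 -> measurable_fun [set: T] f ->
  (\int[P1]_w f (X1 w) = \int[P2]_w f (X2 w))%E.
Proof.
move=> X12 mf.
rewrite [LHS]integralE [RHS]integralE.
rewrite (funepos_comp f X1) (funepos_comp f X2).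
rewrite (funeneg_comp f X1) (funeneg_comp f X2); congr (_ - _)%E.
- by apply: (same_law_ge0_integral X12) => //; exact: measurable_funepos.
- by apply: (same_law_ge0_integral X12) => //; exact: measurable_funeneg.
Qed.

Lemma same_law_integrable (R : realType) d1 (Om1 : measurableType d1)
    (P1 : probability Om1 R) d2 (Om2 : measurableType d2)
    (P2 : probability Om2 R) d (T : measurableType d)
    (X1 : {RV P1 >-> T}) (X2 : {RV P2 >-> T}) (f : T -> \bar R) :
  same_law P1 P2 X1 X2 -> measurable_fun [set: T] f ->
  P2.-integrable [set: Om2] (fun w => f (X2 w)) ->
  P1.-integrable [set: Om1] (fun w => f (X1 w)).
Proof.
move=> X12 mf /integrableP[_ fin2]; apply/integrableP; split.
  by apply: (measurableT_comp mf); exact: measurable_funP.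
rewrite (same_law_ge0_integral (f := fun t => `|f t|%E) X12)//.
exact: measurableT_comp.
Qed.

(** Independence says that the joint law of U and V is the product of their
  laws, so Tonelli's theorem applies. *)
Lemma integral_prod_two (R : realType) d (Omega : measurableType d)
    (P : probability Omega R) d1 (T1 : measurableType d1)
    d2 (T2 : measurableType d2)
    (U : {RV P >-> T1}) (V : {RV P >-> T2})
    (f : T1 -> \bar R) (g : T2 -> \bar R) :
  (forall A B, measurable A -> measurable B ->
     P (U @^-1` A `&` V @^-1` B) = P (U @^-1` A) * P (V @^-1` B))%E ->
  measurable_fun [set: T1] f -> (forall t, 0 <= f t)%E ->
  measurable_fun [set: T2] g -> (forall t, 0 <= g t)%E ->
  (\int[P]_w (f (U w) * g (V w)) =
   \int[P]_w f (U w) * \int[P]_w g (V w))%E.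
Proof.
move=> indUV mf f0 mg g0.
have mUV : measurable_fun [set: Omega] (fun w => (U w, V w)).
  by apply/measurable_fun_pair; exact: measurable_funP.
pose UV_mixin := isMeasurableFun.Build _ _ _ _ _ mUV.
pose UV : {RV P >-> (T1 * T2)%type} := HB.pack (fun w => (U w, V w)) UV_mixin.
pose F (z : T1 * T2) := (f z.1 * g z.2)%E.
have mF : measurable_fun [set: T1 * T2] F.
  apply: emeasurable_funM.
  - by apply: (measurableT_comp mf); exact: measurable_fst.
  - by apply: (measurableT_comp mg); exact: measurable_snd.
have F0 z : (0 <= F z)%E by exact: mule_ge0.
transitivity (\int[distribution P UV]_z F z)%E.
  by rewrite ge0_integral_distribution.
transitivity (\int[distribution P U \x distribution P V]_z F z)%E.
  apply: eq_measure_integral => C mC _; apply/esym.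
  by apply: product_measure_unique => // A B mA mB; exact: indUV.
rewrite fubini_tonelli1//.
transitivity (\int[distribution P U]_x
    (f x * \int[distribution P V]_y g y))%E.
  apply: eq_integral => x _; rewrite /fubini_F /F/=.
  by rewrite ge0_integralZl.
have c0 : (0 <= \int[distribution P V]_y g y)%E by exact: integral_ge0.
rewrite ge0_integralZr//.
by congr (_ * _)%E; rewrite ge0_integral_distribution.
Qed.

(** By induction: the last variable is independent of the tuple of the previous
  ones, again because it suffices to test this on boxes. *)
Lemma integral_prod_product_rule (R : realType) d (Omega : measurableType d)
    (P : probability Omega R) d' (T : measurableType d')
    (k : nat) (Y : 'I_k -> {RV P >-> T}) (f : T -> \bar R) :
  product_rule Y measurable ->
  measurable_fun [set: T] f -> (forall t, 0 <= f t)%E ->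
  (\int[P]_w \prod_(i < k) f (Y i w) = \prod_(i < k) \int[P]_w f (Y i w))%E.
Proof.
move=> + mf f0; elim: k Y => [|k IH] Y prY.
  under eq_integral do rewrite big_ord0.
  rewrite big_ord0 integral_cst// mul1e. exact: probability_setT.
pose W : {RV P >-> k.-tuple T} := joint (fun i => Y (widen_ord (leqnSn k) i)).
have mprod (s : seq 'I_k) :
    measurable_fun [set: k.-tuple T] (fun t => \prod_(i <- s) f (tnth t i))%E.
  elim: s => [|i s IHs].
    by under eq_fun do rewrite big_nil; exact: measurable_cst.
  under eq_fun do rewrite big_cons.
  apply: emeasurable_funM => //.
  by apply: (measurableT_comp mf); exact: measurable_tnth.
pose F (t : k.-tuple T) := (\prod_(i < k) f (tnth t i))%E.
have F0 t : (0 <= F t)%E by apply: prode_ge0.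
under eq_integral do rewrite big_ord_recr/=.
rewrite big_ord_recr/= -IH; last first.
  by apply: (product_rule_inj _ prY) => i j /(congr1 val)/= ?; exact: val_inj.
have WE w : (\prod_(i < k) f (Y (widen_ord (leqnSn k) i) w))%E = F (W w).
  by apply: eq_bigr => i _; rewrite tnth_mktuple.
under eq_integral do rewrite WE.
under [in RHS]eq_integral do rewrite WE.
apply: integral_prod_two => //; last exact: mprod.
move=> A B mA mB; pose C := Y ord_max @^-1` B.
have mC : measurable C by exact: measurable_funPTI.
have c_ge0 : 0 <= fine (P C) by exact: fine_ge0.
(* The measure structure on a pushforward depends on a measurability proof. *)
pose push : {measure set (k.-tuple T) -> \bar R} :=
  pushforward (mrestr P mC) W.
pose m1 := push (@measurable_funP _ _ _ _ setT W).
pose m2 : {measure set (k.-tuple T) -> \bar R} :=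
  mscale (NngNum c_ge0) (distribution P W).
have m2E D : m2 D = (P (W @^-1` D) * P C)%E.
  by rewrite /m2/= /mscale/= fineK ?fin_num_measure// muleC.
rewrite -m2E; apply: (@tuple_measure_unique _ _ _ _ m1 m2) => //.
  rewrite /m1/= /pushforward /mrestr preimage_setT setTI.
  by rewrite ltey_eq fin_num_measure.
move=> {}A {}mA; rewrite m2E joint_box.
(* The events A for the first k variables, followed by B for the last one. *)
pose A' (i : 'I_k.+1) := oapp A B (insub (val i)).
have A'l i : A' (widen_ord (leqnSn k) i) = A i by rewrite /A' valK.
have A'r : A' ord_max = B by rewrite /A' insubF//= ltnn.
transitivity (P (\bigcap_(i in setT) (Y i @^-1` A' i))).
  rewrite /m1/= /pushforward /mrestr/= joint_box; congr (P _).
  apply/seteqP; split=> w /=.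
    move=> [AW Cw] i _; have [j ->|->] := unliftP ord_max i.
      rewrite (_ : lift ord_max j = widen_ord (leqnSn k) j).
        by rewrite A'l; exact: AW.
      by apply: val_inj; rewrite /= /bump leqNgt ltn_ord.
    by rewrite A'r.
  move=> Aw; split; last by rewrite /C/= -A'r; exact: Aw.
  by move=> i _; rewrite /= -A'l; exact: Aw.
rewrite prY; last first.
  by move=> i; rewrite /A'; case: insub.
rewrite big_ord_recr/= A'r; congr (_ * _)%E.
rewrite (product_rule_inj (f := widen_ord (leqnSn k)) _ prY)//.
  by apply: eq_bigr => i _; rewrite A'l.
by move=> i j /(congr1 val)/= ?; exact: val_inj.
Qed.

(** * Convex functions on the line *)

Lemma convex_functionP (R : realType) (Phi : R -> R) :
  convex_function [set: convex_lmodType R^o] Phi <->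
  forall t x y, 0 <= t -> t <= 1 ->
    Phi (t * x + (1 - t) * y) <= t * Phi x + (1 - t) * Phi y.
Proof.
split=> [cvx t x y t0 t1|cvx t x y _ _].
  exact: (cvx (Itv01 t0 t1) x y (in_setT _) (in_setT _)).
by apply: cvx; [exact: ge0|exact: le1].
Qed.

Lemma convex_function_affine (R : realType) (Phi : R -> R) (a b : R) :
  convex_function [set: convex_lmodType R^o] Phi ->
  convex_function [set: convex_lmodType R^o] (fun x => Phi (a * x + b)).
Proof.
move=> /convex_functionP cvx; apply/convex_functionP => t x y t0 t1.
apply: le_trans (cvx t _ _ t0 t1).
by rewrite le_eqVlt; apply/orP; left; apply/eqP; congr Phi; ring.
Qed.

Lemma convex_function_expR (R : realType) :
  convex_function [set: convex_lmodType R^o] (@expR R).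
Proof. by move=> t x y _ _; exact: convex_expR. Qed.

Lemma convex_function_mean (R : realType) (Phi : R -> R) (I : Type)
    (s : seq I) (x : I -> R) :
  convex_function [set: convex_lmodType R^o] Phi -> (0 < size s)%N ->
  Phi ((size s)%:R^-1 * \sum_(i <- s) x i) <=
  (size s)%:R^-1 * \sum_(i <- s) Phi (x i).
Proof.
move=> /convex_functionP cvx; elim: s => // i [|j s] IH _.
  by rewrite !big_seq1 invr1 !mul1r.
move: IH => /(_ isT) IH; rewrite [in leLHS]big_cons [in leRHS]big_cons.
move: IH.
set N := size (j :: s); set A := (\sum_(i <- j :: s) x i).
set B := (\sum_(i <- j :: s) Phi (x i)) => IH.
have N0 : (0 < N%:R :> R) by rewrite ltr0n.
have N10 : (0 < N.+1%:R :> R) by rewrite ltr0n.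
have Nt : (N.+1%:R = 1 + N%:R :> R) by rewrite -natr1 addrC.
pose t : R := N.+1%:R^-1.
have t0 : 0 <= t by rewrite invr_ge0 ltW.
have t1 : t <= 1 by rewrite invf_le1// Nt; lra.
have tE : 1 - t = t * N%:R.
  by rewrite /t Nt; field; rewrite -Nt; exact: lt0r_neq0.
have -> : (size (i :: j :: s))%:R^-1 * (x i + A) =
    t * x i + (1 - t) * (N%:R^-1 * A).
  by rewrite tE mulrDr -mulrA mulVKf// lt0r_neq0.
apply: le_trans (cvx _ _ _ t0 t1) _.
rewrite [leRHS](_ : _ = t * Phi (x i) + (1 - t) * (N%:R^-1 * B)).
  by rewrite lerD2l ler_wpM2l ?subr_ge0.
by rewrite tE [LHS]mulrDr -[in RHS]mulrA mulVKf// lt0r_neq0.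
Qed.

(** Strict sublevel sets of a convex function are intervals. *)
Lemma convex_function_measurable (R : realType) (Phi : R -> R) :
  convex_function [set: convex_lmodType R^o] Phi ->
  measurable_fun [set: R] Phi.
Proof.
move=> /convex_functionP cvx.
apply: (measurability (@RGenInftyO.G R)) => [|/= _ [_] [r] -> <-].
  exact: RGenInftyO.measurableE.
apply: measurableI => //; apply: is_interval_measurable => s t/=.
rewrite !in_itv/= => Phi_s Phi_t u /andP[su ut].
have [st|] := ltP s t; last first.
  by move=> ts; rewrite (_ : u = s)//; apply/le_anti; rewrite su andbT; lra.
pose a := (t - u) / (t - s).
have a0 : 0 <= a by rewrite divr_ge0//; lra.
have a1 : a <= 1 by rewrite ler_pdivrMr; lra.
have uE : u = a * s + (1 - a) * t by rewrite /a; field; lra.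
rewrite uE; apply: le_lt_trans (cvx _ _ _ a0 a1) _.
have [->|a_neq0] := eqVneq a 0; first by rewrite mul0r add0r subr0 mul1r.
have : a * Phi s < a * r by rewrite ltr_pM2l// lt0r a_neq0.
have : (1 - a) * Phi t <= (1 - a) * r by rewrite ler_wpM2l ?subr_ge0// ltW.
by lra.
Qed.

(** For x >= 0, the point 0 lies between x and -1, and convexity bounds Phi x
  from below in terms of Phi 0 and Phi (-1), linearly in x; symmetrically for
  x <= 0 with the point 1. *)
Lemma convex_function_minorant (R : realType) (Phi : R -> R) :
  convex_function [set: convex_lmodType R^o] Phi ->
  exists2 C : R, 0 <= C & forall x, - (C * (1 + `|x|)) <= Phi x.
Proof.
move=> /convex_functionP cvx.
exists (`|Phi 0| + `|Phi 1| + `|Phi (-1)|); first by rewrite !addr_ge0.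
(* e is the sign of the point e * x, and x its absolute value. *)
have minor e x : 0 <= x -> `|Phi (- e)| <= `|Phi 1| + `|Phi (-1)| ->
    - ((`|Phi 0| + `|Phi 1| + `|Phi (-1)|) * (1 + x)) <= Phi (e * x).
  move=> x0 le_e; have x10 : 0 < 1 + x by lra.
  (* 0 = t * (e * x) + (1 - t) * (- e) for this t. *)
  pose t := (1 + x)^-1.
  have t0 : 0 <= t by rewrite invr_ge0 ltW.
  have t1 : t <= 1 by rewrite invf_le1//; lra.
  have := cvx t (e * x) (- e) t0 t1.
  have -> : t * (e * x) + (1 - t) * - e = 0 by rewrite /t; field; lra.
  have -> : 1 - t = t * x by rewrite /t; field; lra.
  rewrite -mulrA -mulrDr -(ler_pM2l x10) mulVKf ?lt0r_neq0// => bnd.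
  have := ler_norm (- Phi 0); have := ler_norm (Phi (- e)).
  rewrite normrN.
  have := normr_ge0 (Phi 0); have := normr_ge0 (Phi (-e)).
  by nra.
move=> x; have [x0|/ltW x0] := leP 0 x.
  have := minor 1 x x0; rewrite mul1r (ger0_norm x0); apply.
  by rewrite lerDr.
have := minor (-1) (- x).
rewrite mulN1r !opprK oppr_ge0 (ler0_norm x0); apply=> //.
by rewrite lerDl.
Qed.

(** * Jensen's inequality for a mean of identically distributed variables *)

(** The lower bound makes the negative part of f integrable, so only the
  positive part can be responsible for the failure of integrability. *)
Lemma integral_nonintegrable_pinfty (R : realType) d (T : measurableType d)
    (mu : {measure set T -> \bar R}) (f g : T -> R) :
  measurable_fun [set: T] f -> mu.-integrable [set: T] (EFin \o g) ->
  (forall x, - g x <= f x) -> ~ mu.-integrable [set: T] (EFin \o f) ->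
  (\int[mu]_x (f x)%:E = +oo)%E.
Proof.
move=> mf intg le_gf nint.
have mF : measurable_fun [set: T] (EFin \o f) by exact/measurable_EFinP.
have intN : mu.-integrable [set: T] (EFin \o f)^\-%E.
  apply: le_integrable intg => //; first exact: measurable_funeneg.
  move=> x _; rewrite gee0_abs ?funeneg_ge0// funenegE ge_max abse_ge0 andbT/=.
  by rewrite lee_fin; have := ler_norm (g x); have := le_gf x; lra.
rewrite integralE; apply/eqP; apply: contra_notT nint => neq_pinfty.
rewrite (funeposneg (EFin \o f)).
apply: integrableB => //; apply/integrableP; split.
  exact: measurable_funepos.
under eq_integral do rewrite gee0_abs ?funepos_ge0//.
rewrite ltey; apply: contra neq_pinfty => /eqP ->.
have := integrable_fin_num measurableT intN.
by case: (\int[mu]_x (EFin \o f)^\- x)%E => //= r ->.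
Qed.

(** Only the marginal laws of the W i enter: Jensen's inequality for the finite
  mean holds pointwise, and linearity of the expectation then involves each
  W i separately. If Phi (V w) is not integrable, its expectation
  is +oo by the linear lower bound. Otherwise all the variables Phi (W i w) are
  integrable, and so is Phi of the mean, which lies between the lower bound and
  the mean of the Phi (W i w). *)
Lemma expectation_convex_mean (R : realType) d (Omega : measurableType d)
    (P : probability Omega R) d' (Omega' : measurableType d')
    (Q : probability Omega' R) (I : Type) (s : seq I)
    (W : I -> {RV P >-> R}) (V : {RV Q >-> R}) (Phi : R -> R) :
  convex_function [set: convex_lmodType R^o] Phi -> (0 < size s)%N ->
  Q.-integrable [set: Omega'] (EFin \o V) ->
  (forall i, same_law P Q (W i) V) ->
  ('E_P[fun w => Phi ((size s)%:R^-1 * \sum_(i <- s) W i w)%R] <=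
   'E_Q[fun w => Phi (V w)])%E.
Proof.
move=> cvx s_gt0 intV lawW; rewrite unlock.
have mPhi := convex_function_measurable cvx.
have [C C0 minor] := convex_function_minorant cvx.
have int_bound d0 (Om : measurableType d0) (Pr : probability Om R)
    (Y : {RV Pr >-> R}) : Pr.-integrable [set: Om] (EFin \o Y) ->
    Pr.-integrable [set: Om] (EFin \o (fun w => C * (1 + `|Y w|))).
  move=> intY; rewrite (_ : _ \o _ = fun w => (C%:E * (1 + `|(Y w)%:E|))%E)//.
  apply: integrableZl => //; apply: integrableD => //.
    exact: finite_measure_integrable_cst.
  exact: integrable_abse.
have [intPhiV|nint] := pselect
  (Q.-integrable [set: Omega'] (EFin \o (fun w => Phi (V w)))); last first.
  rewrite (integral_nonintegrable_pinfty _ (int_bound _ _ _ V intV) _ nint).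
  - exact: leey.
  - by apply: (measurableT_comp mPhi); exact: measurable_funP.
  - by move=> w; exact: minor.
have mE (f : R -> R) : measurable_fun [set: R] f ->
    measurable_fun [set: R] (EFin \o f) by move=> mf; exact/measurable_EFinP.
have intW i : P.-integrable [set: Omega] (EFin \o W i).
  exact: (same_law_integrable (f := EFin) (lawW i)).
have intPhiW i : P.-integrable [set: Omega] (EFin \o (fun w => Phi (W i w))).
  exact: (same_law_integrable (f := EFin \o Phi) (lawW i) (mE _ mPhi)).
have int_mean (F : I -> Omega -> R) :
    (forall i, P.-integrable [set: Omega] (EFin \o F i)) ->
    P.-integrable [set: Omega]
      (EFin \o (fun w => (size s)%:R^-1 * \sum_(i <- s) F i w)).
  move=> intF.
  rewrite (_ : _ \o _ =
      fun w => ((size s)%:R^-1%:E * \sum_(i <- s) (F i w)%:E)%E).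
    by apply: integrableZl => //; apply: integrable_sum => // i _; exact: intF.
  by apply/funext => w /=; rewrite sumEFin.
pose M w := (size s)%:R^-1 * \sum_(i <- s) W i w.
pose G w := (size s)%:R^-1 * \sum_(i <- s) Phi (W i w).
have intM : P.-integrable [set: Omega] (EFin \o M) := int_mean _ intW.
have intG : P.-integrable [set: Omega] (EFin \o G) := int_mean _ intPhiW.
have mM : measurable_fun [set: Omega] M.
  by apply/measurable_EFinP; exact: measurable_int intM.
have le_G w : Phi (M w) <= G w by exact: convex_function_mean.
pose M_mixin := isMeasurableFun.Build _ _ _ _ _ mM.
pose MV : {RV P >-> R} := HB.pack M M_mixin.
(* Phi (M w) lies between the linear minorant at M w and G w. *)
have intPhiM : P.-integrable [set: Omega] (EFin \o (fun w => Phi (M w))).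
  apply: (@le_integrable _ _ _ _ _ _ _
    (fun w => (C * (1 + `|M w|))%:E + `|(G w)%:E|)%E) => //.
  - by apply/measurable_EFinP; exact: (measurableT_comp mPhi).
  - move=> w _ /=; rewrite lee_fin [leRHS]ger0_norm; last first.
      by rewrite addr_ge0// mulr_ge0// addr_ge0.
    rewrite ler_norml; apply/andP; split.
      by have := minor (M w); have := normr_ge0 (G w); lra.
    apply: le_trans (le_G w) _; apply: le_trans (ler_norm _) _.
    by rewrite lerDr mulr_ge0// addr_ge0.
  - apply: integrableD => //; first exact: (int_bound _ _ _ MV intM).
    exact: integrable_abse.
apply: (@le_trans _ _ (\int[P]_w (G w)%:E)%E).
  by apply: (le_integral _ intPhiM intG) => // w _; rewrite lee_fin le_G.
have -> : (\int[P]_w (G w)%:E)%E =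
    ((size s)%:R^-1%:E * \sum_(i <- s) \int[P]_w (Phi (W i w))%:E)%E.
  rewrite -integral_sum// -integralZl//; last first.
    by apply: integrable_sum => // i _; exact: intPhiW.
  by apply: eq_integral => w _; rewrite sumEFin.
rewrite (eq_bigr (fun=> \int[Q]_w (Phi (V w))%:E)%E); last first.
  move=> i _; exact: (same_law_integral (lawW i) (mE _ mPhi)).
have [r ->] : exists r, (\int[Q]_w (Phi (V w))%:E = r%:E)%E.
  exists (fine (\int[Q]_w (Phi (V w))%:E)%E).
  by rewrite fineK//; exact: integrable_fin_num intPhiV.
rewrite sumEFin -EFinM lee_fin big_const_seq count_predT iter_addr addr0.
by rewrite -[r *+ _]mulr_natl mulKf// pnatr_eq0 -lt0n.
Qed.

(** * Block means *)

Definition tuple_mean (R : realType) (k : nat) (t : k.-tuple R) : R :=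
  sample_mean (tnth t).

Lemma measurable_tuple_mean (R : realType) (k : nat) :
  measurable_fun [set: k.-tuple R] (@tuple_mean R k).
Proof.
apply: measurable_funM; first exact: measurable_cst.
by apply: measurable_sum => i; exact: measurable_tnth.
Qed.

HB.instance Definition _ (R : realType) (k : nat) :=
  isMeasurableFun.Build _ _ _ _ (@tuple_mean R k) (@measurable_tuple_mean R k).

Lemma tuple_mean_joint (R : realType) d (Omega : measurableType d) (k : nat)
    (Y : 'I_k -> {mfun Omega >-> R}) (w : Omega) :
  tuple_mean (joint Y w) = sample_mean (fun i => Y i w).
Proof.
rewrite /tuple_mean /sample_mean; congr (_ * _).
by apply: eq_bigr => i _; rewrite tnth_mktuple.
Qed.

(** The law of m of the variables does not depend on which distinct ones are
  chosen, nor on their order. *)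
Lemma iid_joint_same_law (R : realType) d (Omega : measurableType d)
    (P : probability Omega R) d' (T : measurableType d') (m n : nat)
    (X : 'I_n -> {RV P >-> T}) (f g : 'I_m -> 'I_n) :
  iid X -> injective f -> injective g ->
  same_law P P (joint (X \o f)) (joint (X \o g)).
Proof.
move=> [/mutually_independent_product_rule prX lawX] f_inj g_inj.
apply: joint_same_law; [exact: product_rule_inj|exact: product_rule_inj|].
by move=> j; exact: lawX.
Qed.

Definition block_RV (R : realType) d (Omega : measurableType d)
    (P : probability Omega R) d' (T : measurableType d') (m n : nat)
    (h : {mfun m.-tuple T >-> R}) (X : 'I_n -> {RV P >-> T}) (s : 'S_n)
    (i : 'I_(n %/ m)) : {RV P >-> R} :=
  h \o joint (fun j => X (s (block_index i j))).

(** The permuted blocks are disjoint sets of indices. *)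
Lemma block_RV_product_rule (R : realType) d (Omega : measurableType d)
    (P : probability Omega R) d' (T : measurableType d') (m n : nat)
    (h : {mfun m.-tuple T >-> R}) (X : 'I_n -> {RV P >-> T}) (s : 'S_n) :
  iid X -> product_rule (block_RV h X s) measurable.
Proof.
move=> [/mutually_independent_product_rule prX _].
apply: (product_rule_comp (Y := fun i : 'I_(n %/ m) =>
  joint (fun j => X (s (block_index i j))) : {RV P >-> m.-tuple T})).
apply: (product_rule_joint (Y := fun p => X (s (block_index p.1 p.2)))).
apply: (product_rule_inj (f := fun p => s (block_index p.1 p.2)) _ prX).
by move=> [i j] [i' j'] /perm_inj/block_index_inj/= [-> ->].
Qed.

Definition block_mean_RV (R : realType) d (Omega : measurableType d)
    (P : probability Omega R) d' (T : measurableType d') (m n : nat)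
    (h : {mfun m.-tuple T >-> R}) (X : 'I_n -> {RV P >-> T}) (s : 'S_n) :
    {RV P >-> R} :=
  @tuple_mean R (n %/ m) \o joint (block_RV h X s).

Lemma block_mean_RVE (R : realType) d (Omega : measurableType d)
    (P : probability Omega R) d' (T : measurableType d') (m n : nat)
    (h : {mfun m.-tuple T >-> R}) (X : 'I_n -> {RV P >-> T}) (s : 'S_n) w :
  block_mean_RV h X s w = block_mean h ((fun i => X i w) \o s).
Proof. exact: tuple_mean_joint. Qed.

(** For each s, the block values are independent with the common law of the
  Z i, so the tuples of block values and of the Z i have the same law, and so
  have their means. *)
Lemma block_mean_same_law (R : realType) d (Omega : measurableType d)
    (P : probability Omega R) d' (T : measurableType d') (m n : nat)
    (le_mn : (m <= n)%N)
    (h : {mfun m.-tuple T >-> R}) (X : 'I_n -> {RV P >-> T})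
    d'' (Omega' : measurableType d'') (Q : probability Omega' R)
    (Z : 'I_(n %/ m) -> {RV Q >-> R}) (s : 'S_n) :
  iid X -> iid Z ->
  (forall i, same_law Q P (Z i)
     (fun w => h (first_vars le_mn (fun i => X i w)))) ->
  same_law P Q (block_mean_RV h X s) (@tuple_mean R (n %/ m) \o joint Z).
Proof.
move=> iidX iidZ lawZ A mA.
have mA' : measurable (@tuple_mean R (n %/ m) @^-1` A).
  exact: measurable_funPTI.
apply: (joint_same_law _ _ _ mA') => [||i B mB].
- exact: block_RV_product_rule.
- exact: mutually_independent_product_rule iidZ.1.
rewrite lawZ//.
have mB' : measurable (h @^-1` B) by exact: measurable_funPTI.
apply: (iid_joint_same_law (f := fun j => s (block_index i j))
  (g := widen_ord le_mn) iidX _ _ mB').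
  by move=> j j' /perm_inj/block_index_inj[].
by move=> j j' /(congr1 val)/= ?; exact: val_inj.
Qed.

(** The exponential turns the sum over i of (s / k) (Z_i - c) into a product of
  independent factors, whose expectations are all equal to that of i0. *)
Lemma expectation_expR_sample_mean (R : realType) d (Omega : measurableType d)
    (P : probability Omega R) (k : nat) (Z : 'I_k -> {RV P >-> R})
    (i0 : 'I_k) (s c : R) : iid Z ->
  ('E_P[fun w => expR (s * (sample_mean (fun i => Z i w) - c))%R] =
   'E_P[fun w => expR (s / k%:R * (Z i0 w - c))%R] ^+ k)%E.
Proof.
move=> [/mutually_independent_product_rule prZ lawZ]; rewrite unlock.
have k_neq0 : k%:R != 0 :> R.
  by rewrite pnatr_eq0 -lt0n (leq_ltn_trans _ (ltn_ord i0)).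
pose f (z : R) := (expR (s / k%:R * (z - c)))%:E.
have mf : measurable_fun [set: R] f.
  apply/measurable_EFinP; apply: measurableT_comp => //.
  by apply: measurable_funM => //; exact: measurable_funB.
have f0 z : (0 <= f z)%E by rewrite lee_fin expR_ge0.
transitivity (\int[P]_w \prod_(i < k) f (Z i w))%E.
  apply: eq_integral => w _; rewrite prodEFin -expR_sum; congr (expR _)%:E.
  rewrite -mulr_sumr sumrB sumr_const card_ord -[c *+ k]mulr_natr.
  by rewrite /sample_mean; field.
rewrite integral_prod_product_rule//.
rewrite (eq_bigr (fun=> \int[P]_w f (Z i0 w))%E); last first.
  by move=> i _; exact: same_law_ge0_integral (lawZ i i0) mf f0.
rewrite big_const_ord.
have iterE x j : iter j (mule x) 1%E = (x ^+ j)%E :> \bar R.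
  by elim: j => // j IHj; rewrite expeS -IHj.
exact: iterE.
Qed.

(** * Hoeffding's inequality for U-statistics *)

Theorem lemma3p1 (R : realType) (m n : nat)
    (le2m : (2 <= m)%N) (le_mn : (m <= n)%N)
    (d : measure_display) (Omega : measurableType d) (P : probability Omega R)
    (dX : measure_display) (T : measurableType dX)
    (X : 'I_n -> {RV P >-> T}) (iidX : iid X)
    (h : m.-tuple T -> R) (mh : measurable_fun [set: m.-tuple T] h)
    (Eh : ('E_P[fun w => `|h (first_vars le_mn (fun i => X i w))|%R] < +oo)%E)
    (dZ : measure_display) (Omega' : measurableType dZ)
    (Q : probability Omega' R)
    (Z : 'I_(n %/ m) -> {RV Q >-> R}) (iidZ : iid Z)
    (Zh : forall i, same_law Q P (Z i)
                      (fun w => h (first_vars le_mn (fun i => X i w)))) :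
  let k := (n %/ m)%N in
  let m_h := fine ('E_P[fun w => h (first_vars le_mn (fun i => X i w))])%E in
  let U := fun w => Ustat h (fun i => X i w) in
  let Zbar := fun w => sample_mean (fun i => Z i w) in
  let Z1 := Z (Ordinal (divn_gt0_of_le le2m le_mn)) in
  (forall Phi : R -> R, convex_function [set: convex_lmodType R^o] Phi ->
     ('E_P[fun w => Phi (U w - m_h)%R] <= 'E_Q[fun w => Phi (Zbar w - m_h)%R])%E)
  /\
  (forall s : R,
     ('E_P[fun w => expR (s * (U w - m_h))%R] <=
      'E_Q[fun w => expR (s / k%:R * (Z1 w - m_h))%R] ^+ k)%E).
Proof.
move=> k m_h U Zbar Z1.
have k_gt0 : (0 < k)%N by exact: divn_gt0_of_le.
pose h_mixin := isMeasurableFun.Build _ _ _ _ _ mh.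
pose H : {mfun m.-tuple T >-> R} := HB.pack h h_mixin.
pose V : {RV Q >-> R} := @tuple_mean R k \o joint Z.
have VE w : V w = Zbar w by exact: tuple_mean_joint.
pose h_first : {RV P >-> R} := H \o joint (X \o widen_ord le_mn).
have intZ i : Q.-integrable [set: Omega'] (EFin \o Z i).
  apply: (same_law_integrable (X2 := h_first) (f := EFin) (Zh i)) => //.
  apply/integrableP; split.
    by apply/measurable_EFinP; exact: (measurable_funP h_first).
  by move: Eh; rewrite unlock.
have intV : Q.-integrable [set: Omega'] (EFin \o V).
  rewrite (_ : _ \o _ = fun w => (k%:R^-1%:E * \sum_(i < k) (Z i w)%:E)%E).
    apply: integrableZl => //.
    by apply: integrable_sum => // i _; exact: intZ.
  apply/funext => w; transitivity (Zbar w)%:E; first by rewrite -VE.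
  by rewrite sumEFin -EFinM.
have convex_part (Phi : R -> R) :
    convex_function [set: convex_lmodType R^o] Phi ->
    ('E_P[fun w => Phi (U w - m_h)%R] <= 'E_Q[fun w => Phi (Zbar w - m_h)%R])%E.
  move=> /(convex_function_affine 1 (- m_h)) cvx.
  have sizeS : size (enum 'S_n) = n`! by rewrite -cardE card_Sn.
  (* Phi is translated by m_h so that its argument is exactly the mean of W. *)
  have := @expectation_convex_mean _ _ _ _ _ _ _ _ (enum 'S_n)
    (block_mean_RV H X) V _ cvx _ intV
    (fun s =>
      block_mean_same_law (le_mn := le_mn) (h := H) s iidX iidZ Zh).
  rewrite sizeS fact_gt0 => /(_ isT).
  congr (_ <= _)%E; congr expectation; apply/funext => w.
    rewrite mul1r big_enum/= /U (Ustat_mean_block_mean h _ k_gt0).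
    congr (Phi (_ * _ - _)); apply: eq_bigr => s _.
    exact: block_mean_RVE.
  by rewrite mul1r VE.
split=> // s.
rewrite -(expectation_expR_sample_mean _ _ _ iidZ).
have := convex_part _ (convex_function_affine s 0 (@convex_function_expR R)).
by congr (_ <= _)%E; congr expectation; apply/funext => w; rewrite addr0.
Qed.
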